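(* Let $G$ be a finite bipartite planar graph with black vertices $B=\{b_1,\dots,b_N\}$ and white vertices $W=\{w_1,\dots,w_N\}$ that has at least one dimer covering, and let $K$ be an $N\times N$ Kasteleyn matrix for $G$ (rows indexed by $B$, columns by $W$). Let $E$ be the set of edges of $G$ crossed by a path $p$ between two faces of $G$, and for a dimer covering $\mathcal{C}$ let $\eta_E(\mathcal{C})$ be the number of dimers of $\mathcal{C}$ on edges of $E$. Define $N\times N$ matrices $$\tilde K(b,w)=\begin{cases}-K(b,w),&(b,w)\in E\\ K(b,w),&\text{otherwise}\end{cases},\qquad K'(b,w)=\begin{cases}K(b,w),&(b,w)\in E\\ 0,&\text{otherwise.}\end{cases}$$ Let $B_E\subseteq B$ and $W_E\subseteq W$ be the sets of black and white endpoints of edges in $E$, let $(K')_E$ be the submatrix of $K'$ with rows $B_E$ and columns $W_E$, and let $(K^{-1})_E$ be the submatrix of $K^{-1}$ with rows $W_E$ and columns $B_E$. Then the vison correlator $\langle(-1)^{\eta_E}\rangle$ satisfies $$\langle(-1)^{\eta_E}\rangle=\frac{\sum_{\mathcal{C}}(-1)^{\eta_E(\mathcal{C})}}{\sum_{\mathcal{C}}1}=\frac{\det\tilde K}{\det K}=\det\big(I-2(K')_E(K^{-1})_E\big),$$ where the sums run over all dimer coverings $\mathcal{C}$ of $G$ and $I$ is the identity matrix of size $|B_E|$ (equal to $\ell=|E|$ when the edges of $E$ have no common endpoints).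
   Context: A dimer covering of a graph is a perfect matching. A Kasteleyn matrix $K$ for a bipartite planar graph is a signed bipartite adjacency matrix: $K(b,w)\in\{+1,-1\}$ if $(b,w)$ is an edge and $K(b,w)=0$ otherwise, with signs given by a Kasteleyn orientation (an assignment of directions to the edges such that every face has an odd number of edges oriented clockwise around its boundary; $K(b,w)=1$ if the edge is directed from $b$ to $w$ and $-1$ otherwise). Its defining property (Kasteleyn) is that all nonzero terms $\operatorname{sgn}(\sigma)K(b_1,w_{\sigma(1)})\cdots K(b_N,w_{\sigma(N)})$, $\sigma\in S_N$, in the expansion of $\det K$ have the same sign, so that $|\det K|$ equals the number of dimer coverings. The average $\langle\cdot\rangle$ is over the uniform distribution on dimer coverings. *)

(* Defs.v *)
From HB Require Import structures.
From mathcomp Require Import all_boot all_order all_fingroup all_algebra.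

Set Implicit Arguments.
Unset Strict Implicit.
Unset Printing Implicit Defensive.

Import Order.TTheory GRing.Theory Num.Theory.

Local Open Scope ring_scope.

(* Plane graphs are described combinatorially, by a rotation system of Euler  *)
(* characteristic 2, rather than by a drawing in the topological plane.       *)

Record sgraph (V : finType) := SGraph {
  adj :> rel V;
  adj_sym : symmetric adj;
  adj_irr : irreflexive adj
}.

Section PlaneGraphs.

Variables (V : finType) (G : sgraph V).

Definition dart : predArgType := {d : V * V | G d.1 d.2}.

HB.instance Definition _ := Finite.on dart.

Definition tail (d : dart) : V := (val d).1.
Definition head (d : dart) : V := (val d).2.

Fact flip_subproof (d : dart) : G (head d) (tail d).
Proof. by rewrite adj_sym; exact: (valP d). Qed.

Definition flip (d : dart) : dart :=
  Sub (head d, tail d) (flip_subproof d).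

Fact flipK : involutive flip.
Proof. by case=> [[x y] xy]; apply: val_inj. Qed.

Definition flip_perm : {perm dart} := perm (inv_inj flipK).

(* If rot turns each dart to the next one counterclockwise around its tail,   *)
(* then d |-> rot (flip d) follows a boundary contour of the face lying to    *)
(* the right of d, keeping that face on the right, that is, clockwise around  *)
(* the face.                                                                  *)
Definition contour (rot : {perm dart}) : {perm dart} := (flip_perm * rot)%g.

Definition non_isolated : {pred V} := [pred v | [exists u, G v u]].

(* G may be disconnected, in which case a face can have several boundary      *)
(* contours; face_of d is the face to the right of d. Euler's formula is      *)
(* required twice: contour_euler says that each component (isolated vertices  *)
(* have no contour and are left out) is drawn with genus 0, and face_euler    *)
(* is V - E + F = 1 + c for the whole drawing. Together with face_connect,    *)
(* which says that the surface is connected, they force the incidence graph   *)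
(* of components and faces to be a tree, so that the surface is a sphere.     *)
(* If G is connected, the faces are exactly the contours.                     *)
Record plane_embedding := PlaneEmbedding {
  rot : {perm dart};
  face : finType;
  face_of : dart -> face;
  rot_vertex : forall d, porbit rot d = [set d' | tail d' == tail d];
  contour_euler :
    (#|non_isolated| + #|porbits (contour rot)|
       = #|dart|./2 + 2 * n_comp G non_isolated)%N;
  face_contour : forall d, face_of (contour rot d) = face_of d;
  face_onto : forall (f : face), dart -> exists d, face_of d = f;
  face_connect : forall d d',
    connect [rel x y | connect G (tail x) (tail y) || (face_of x == face_of y)]
      d d';
  face_euler : (#|V| + #|face| = #|dart|./2 + n_comp G V + 1)%N
}.

(* o x y means that the edge {x, y} is directed from x to y. For a face with  *)
(* several boundary contours (disconnected G only), the parity condition is   *)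
(* imposed on each of them: imposing it on their union would make Kasteleyn's *)
(* theorem false, for instance for three nested 4-cycles.                      *)
Definition kasteleyn_orientation (M : plane_embedding) (o : rel V) : Prop :=
  (forall x y, G x y -> o y x = ~~ o x y) /\
  (forall d, odd #|[set d' in porbit (contour (rot M)) d
                     | o (tail d') (head d')]|).

(* A path in the plane from f to g is recorded by the darts it crosses, each  *)
(* one from its right to its left.                                            *)
Fixpoint face_path (M : plane_embedding) (f : face M) (p : seq dart)
    (g : face M) : bool :=
  if p is d :: p' then (face_of M d == f) && face_path (face_of M (flip d)) p' g
  else f == g.

End PlaneGraphs.

Section Dimers.

(* The black vertices are the inl b, the white ones the inr w; the edge       *)
(* {inl b, inr w} is represented by the pair (b, w).                          *)
Variables (N : nat) (G : sgraph ('I_N + 'I_N)%type).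

Definition bipartite : Prop :=
  (forall b b', ~~ G (inl b) (inl b')) /\ (forall w w', ~~ G (inr w) (inr w')).

Definition is_edge (e : 'I_N * 'I_N) : bool := G (inl e.1) (inr e.2).

Definition dimer_covering (C : {set 'I_N * 'I_N}) : bool :=
  [&& [forall e in C, is_edge e],
      [forall b, #|[set e in C | e.1 == b]| == 1%N] &
      [forall w, #|[set e in C | e.2 == w]| == 1%N]].

Definition dimer_average (R : numFieldType) (X : {set 'I_N * 'I_N} -> R) : R :=
  \sum_(C | dimer_covering C) #|[set C' | dimer_covering C']|%:R^-1 * X C.

Definition kasteleyn_matrix (R : numFieldType) (M : plane_embedding G)
    (K : 'M[R]_N) : Prop :=
  exists2 o, kasteleyn_orientation M o &
    K = \matrix_(b, w) if is_edge (b, w) then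
                         if o (inl b) (inr w) then 1 else -1
                       else 0.

Definition crossed_edges (p : seq (dart G)) : {set 'I_N * 'I_N} :=
  [set e | has (fun d => (val d == (inl e.1, inr e.2))
                         || (val d == (inr e.2, inl e.1))) p].

End Dimers.

Section Matrices.

Variables (R : numFieldType) (N : nat).
Variables (E : {set 'I_N * 'I_N}) (K : 'M[R]_N).

Definition black_ends : {set 'I_N} := [set e.1 | e in E].
Definition white_ends : {set 'I_N} := [set e.2 | e in E].

Definition tilde_mx : 'M[R]_N :=
  \matrix_(b, w) if (b, w) \in E then - K b w else K b w.

Definition prime_mx : 'M[R]_N :=
  \matrix_(b, w) if (b, w) \in E then K b w else 0.

End Matrices.

Definition submx_on (R : numFieldType) (N : nat) (I J : {set 'I_N})
    (A : 'M[R]_N) : 'M[R]_(#|I|, #|J|) :=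
  mxsub (enum_val (A := mem I)) (enum_val (A := mem J)) A.

(* Main.v *)
Require Import Defs.
From mathcomp Require Import all_boot all_order all_fingroup all_algebra.

(* The heart of the matter is Kasteleyn's theorem: all nonzero terms of the   *)
(* expansion of det K have the same sign. Given the permutations sigma, tau   *)
(* of two dimer coverings, Euler's formula makes the sequence                 *)
(* (contours) -> (edges) -> (vertices) exact over F_2, so the symmetric       *)
(* difference of the coverings is the boundary of a set s of contours. The    *)
(* parity of a permutation of n points is that of n minus its number of       *)
(* cycles; so taking signs in the factorization of the contour permutation,   *)
(* restricted to s, into flips and rotations replaces the count of vertices,  *)
(* edges and faces inside each cycle (and the Jordan curve theorem): it gives *)
(* the sign of the permutation following the boundary of s as the parity of   *)
(* the boundary darts that agree with the orientation. This boundary is the   *)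
(* alternating cycles of sigma and tau, up to the reversal of some of them,   *)
(* which does not change signs.                                               *)
(* Then det K and det (tilde_mx E K) are, up to the same factor, the plain    *)
(* and the signed count of coverings, and the determinant over B_E is         *)
(* Sylvester's identity det (1 + XY) = det (1 + YX).                          *)

Set Implicit Arguments.
Unset Strict Implicit.
Unset Printing Implicit Defensive.

Import Order.TTheory GRing.Theory Num.Theory.

Local Open Scope ring_scope.

(** * Signs of permutations *)

(** The core is [kasteleyn_term]: the permutations of any two coverings contribute equal terms to
    det K. Their symmetric difference has even degree at every vertex, so by Euler's formula it
    bounds a union s of contours ([planar_coboundary]). On the darts of s, following the contours is
    the same as flipping (or turning along the boundary) and then rotating around a vertex. The
    signs of these permutations come from counting cycles. A contour in s may be counted by its odd
    number of darts that agree with the orientation ([odd_contour_perm]), an edge inside s has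
    exactly one such dart ([odd_inner_perm]), and the vertices of s are paired off by a matching
    ([even_region_vertices]). What survives is that the walk along the boundary has the parity of
    its agreeing darts ([odd_boundary_perm]); [alternating_parity] and [kasteleyn_sign_parity] turn
    this into a statement on the signs of sigma and tau.

    Hence both determinants are one nonzero constant times a weighted count of coverings
    ([det_kasteleyn]), and the constant cancels in the quotient. The reduction to the ends of E
    ([det_tilde_ratio]) uses that K' is supported on B_E x W_E. *)

Section PermParity.

Variables T T' : finType.
Implicit Types (p q : {perm T}) (A : {set T}).

(** The sign is the parity of points plus cycles, and a fixed point counts once in each. *)
Lemma odd_perm_fix_out p A :
    (forall x, x \notin A -> p x = x) ->
  odd_perm p = odd #|A| (+) odd #|porbit p @: A|.
Proof.
move=> fixp.
have orb1 x : x \notin A -> porbit p x = [set x].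
  move=> xA; apply/setP=> y; rewrite inE; apply/porbitP/eqP => [[i ->]|->].
    by elim: i => [|i IHi]; rewrite ?expg0 ?perm1 // expgSr permM IHi fixp.
  by exists 0; rewrite expg0 perm1.
have defP : porbits p = (porbit p @: A) :|: (porbit p @: ~: A).
  rewrite /porbits -imsetU setUCr.
  by apply/setP=> O; apply/imsetP/imsetP=> -[x _ ->]; exists x.
have dis : (porbit p @: A) :&: (porbit p @: ~: A) = set0.
  apply/setP=> O; rewrite !inE; apply/negbTE/negP => /andP[/imsetP[x xA ->]].
  case/imsetP=> y; rewrite inE => yA eqO.
  have := porbit_id p x; rewrite eqO orb1 // inE => /eqP eqxy.
  by rewrite -eqxy xA in yA.
have cC : #|porbit p @: ~: A| = #|~: A|.
  apply: card_in_imset => x y; rewrite !inE => xA yA; rewrite !orb1 //.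
  by move/set1_inj.
rewrite /odd_perm /= defP cardsU dis cards0 subn0 cC oddD -(cardsC A) oddD.
by case: (odd #|A|); case: (odd #|~: A|); case: (odd _).
Qed.

(** Conjugation by a map injective only on the support. Composing with the transpositions that make
    [x] and [g x] fixed removes one point of [A]. *)
Lemma odd_perm_transport p A (q : {perm T'}) (g : T -> T') :
    {in A &, injective g} ->
    (forall x, x \notin A -> p x = x) ->
    (forall y, y \notin g @: A -> q y = y) ->
    {in A, forall x, q (g x) = g (p x)} ->
  odd_perm p = odd_perm q.
Proof.
elim: {A}_.+1 {-2}A p q (ltnSn #|A|) => // n IHn A p q; rewrite ltnS => leAn ginj fixp fixq pq.
have [A0|[x xA]] := set_0Vmem A.
  have -> : p = 1%g by apply/permP=> x; rewrite perm1 fixp // A0 inE.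
  have -> : q = 1%g; last by rewrite !odd_perm1.
  by apply/permP=> x; rewrite perm1 fixq // A0 imset0 inE.
have pA y : y \in A -> p y \in A.
  move=> yA; apply/negPn/negP => pyA; have /perm_inj eqy := fixp _ pyA.
  by rewrite eqy yA in pyA.
pose p' := (p * tperm x (p x))%g; pose q' := (q * tperm (g x) (g (p x)))%g.
have p'E y : y \notin A :\ x -> p' y = y.
  rewrite !inE negb_and negbK => /orP[/eqP->|yA]; rewrite permM ?tpermR //.
  by rewrite (fixp y) // tpermD //; apply: contraNneq yA => <- //; apply: pA.
have q'E y : y \notin g @: (A :\ x) -> q' y = y.
  move=> yA; have [->|ynx] := eqVneq y (g x).
    by rewrite permM pq ?tpermR.
  have ygA : y \notin g @: A.
    apply: contra yA => /imsetP[t tA eqy]; apply/imsetP; exists t => //.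
    by rewrite !inE tA andbT; apply: contraNneq ynx => <-; rewrite eqy.
  rewrite permM (fixq y) // tpermD //; first by rewrite eq_sym.
  by apply: contraNneq ygA => <-; apply: imset_f; apply: pA.
have pq' : {in A :\ x, forall y, q' (g y) = g (p' y)}.
  move=> y; rewrite !inE => /andP[ynx yA]; rewrite !permM pq //.
  have pyA := pA _ yA; have pxA := pA _ xA.
  have [e1|n1] := eqVneq (p y) x.
    by rewrite e1 !tpermL.
  have n2 : p y != p x by rewrite (inj_eq perm_inj).
  rewrite !tpermD // 1?eq_sym //.
    by apply: contraNneq n1 => /ginj ->.
  by apply: contraNneq n2 => /ginj ->.
have := IHn (A :\ x) p' q' _ _ p'E q'E pq'.
rewrite !odd_permM !odd_tperm (inj_in_eq ginj) ?pA // => IH.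
have : odd_perm p (+) (x != p x) = odd_perm q (+) (x != p x).
  apply: IH; first by move: leAn; rewrite (cardsD1 x) xA.
  by move=> y z; rewrite !inE => /andP[_ yA] /andP[_ zA]; apply: ginj.
by case: (odd_perm p); case: (odd_perm q); case: (x != p x).
Qed.

(** [A] holds one point of every 2-cycle of [p]. *)
Lemma odd_perm_involution p A :
    involutive p -> {in A, forall x, p x \notin A} ->
    (forall x, x \notin A -> p x \notin A -> p x = x) ->
  odd_perm p = odd #|A|.
Proof.
elim: {A}_.+1 {-2}A p (ltnSn #|A|) => // n IHn A p; rewrite ltnS => leAn pK pA fixp.
have [A0|[x xA]] := set_0Vmem A.
  have -> : p = 1%g by apply/permP=> x; rewrite perm1 fixp // A0 inE.
  by rewrite odd_perm1 A0 cards0.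
have nx : x != p x by apply: contraNneq (pA x xA) => <-.
pose p' := (p * tperm x (p x))%g.
have p'E y : p' y = if (y == x) || (y == p x) then y else p y.
  rewrite permM; have [->|n1] := eqVneq y x; first by rewrite tpermR.
  have [->|n2] := eqVneq y (p x); first by rewrite pK tpermL.
  rewrite tpermD //; last by rewrite eq_sym (inj_eq perm_inj).
  by rewrite eq_sym (can2_eq pK pK).
have := IHn (A :\ x) p' _ _ _ _.
rewrite odd_permM odd_tperm nx [#|A|](cardsD1 x) xA /= => <-.
- by case: (odd_perm p).
- by move: leAn; rewrite (cardsD1 x) xA.
- move=> y; rewrite [p' y]p'E; case: ifP => [c|/norP[n1 n2]]; rewrite p'E ?c //.
  by rewrite (inj_eq perm_inj) (can2_eq pK pK) (negPf n1) (negPf n2) pK.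
- move=> y; rewrite !inE p'E => /andP[n1 yA]; rewrite (negPf n1) /=.
  have [e|_] := eqVneq y (p x); last by rewrite (negPf (pA y yA)) andbF.
  by rewrite e (negPf (pA x xA)) in yA.
move=> y; rewrite !inE p'E.
case: ifP => //= /norP[n1 n2]; rewrite n1 /= => yA.
rewrite (can2_eq pK pK) n2 /=; exact: fixp.
Qed.

(** Here [q] inverts the cycles of [p] outside [A]. Then [p] is [q] times the square of the
    permutation that is [p] off [A] and the identity on [A]. *)
Lemma odd_perm_reverse p q A :
    (forall x, (p x \in A) = (x \in A)) ->
    {in A, forall x, q x = p x} ->
    (forall x, x \notin A -> q (p x) = x) ->
  odd_perm q = odd_perm p.
Proof.
move=> pA qp qpK.
have r_inj : injective (fun x => if x \in A then x else p x).
  move=> x y; have [xA|xA] := boolP (x \in A); have [yA|yA] := boolP (y \in A) => //.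
  - by move=> e; rewrite e pA (negPf yA) in xA.
  - by move=> e; rewrite -e pA (negPf xA) in yA.
  exact: perm_inj.
have -> : p = (q * (perm r_inj * perm r_inj))%g.
  apply/permP=> x; rewrite !permM.
  have [xA|xA] := boolP (x \in A).
    by rewrite qp // !permE pA xA pA xA.
  have qA : q @: A = A.
    apply/eqP; rewrite eqEcard card_imset ?leqnn ?andbT; last exact: perm_inj.
    by apply/subsetP=> _ /imsetP[t tA ->]; rewrite qp // pA.
  have qxA : q x \notin A.
    by rewrite -qA (mem_imset _ _ (@perm_inj _ q)).
  have ppx : p (q x) = x.
    by apply: (@perm_inj _ q); rewrite qpK.
  by rewrite !permE (negPf qxA) ppx (negPf xA).
by rewrite !odd_permM addbb addbF.
Qed.

Lemma card_half_involution (j : T -> T) A (P : pred T) :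
    involutive j -> {in A, forall x, j x \in A} ->
    {in A, forall x, P (j x) = ~~ P x} ->
  #|A| = #|[set x in A | P x]|.*2.
Proof.
move=> jK jA jP; rewrite -addnn -[LHS](cardsID [set x | P x]).
rewrite (_ : A :&: _ = [set x in A | P x]); last by apply/setP=> x; rewrite !inE.
congr (_ + _)%N; rewrite -(card_imset _ (can_inj jK)); apply: eq_card => x.
rewrite !inE; apply/imsetP/andP => [[y]|[xA Px]].
  by rewrite !inE => /andP[Py yA] ->; rewrite jA // jP.
by exists (j x); rewrite ?jK // !inE jP ?Px ?jA.
Qed.

End PermParity.

(** * Exactness from Euler's formula *)

Section Exactness.

Variable K : fieldType.

(** The left kernel of [A] embeds into k coordinates through [P]. *)
Lemma leq_rank_detected m n k (A : 'M[K]_(m, n)) (P : 'M[K]_(m, k)) :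
    (forall u : 'rV_m, u *m A = 0 -> u *m P = 0 -> u = 0) ->
  (m <= \rank A + k)%N.
Proof.
move=> AP; have fAP : row_free (row_mx A P).
  apply: inj_row_free => u; rewrite mul_mx_row => /eqP.
  by rewrite row_mx_eq0 => /andP[/eqP uA /eqP uP]; apply: AP.
apply: (@leq_trans (\rank (row_mx A P))); first by rewrite (eqP fAP).
rewrite -mxrank_tr tr_row_mx -addsmxE.
apply: leq_trans (mxrank_adds_leqif _ _).1 _.
by rewrite mxrank_tr leq_add2l rank_leq_row.
Qed.

(** The rows of [B] lie in the kernel of [A^T], of dimension e - rank A. The bounds and the Euler
    relation make rank B at least that, so the two spaces coincide. *)
Lemma exact_of_rank v e f c (A : 'M[K]_(v, e)) (B : 'M[K]_(f, e)) (x : 'rV_e) :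
    (v <= \rank A + c)%N -> (f <= \rank B + c)%N -> (v + f = e + 2 * c)%N ->
    B *m A^T = 0 -> x *m A^T = 0 ->
  (x <= B)%MS.
Proof.
move=> rA rB euler BA xA.
have BsubZ : (B <= kermx A^T)%MS by apply/sub_kermxP.
have xZ : (x <= kermx A^T)%MS by apply/sub_kermxP.
apply: submx_trans xZ _; rewrite -(mxrank_leqif_sup BsubZ) eqn_leq mxrankS //=.
rewrite mxrank_ker mxrank_tr leq_subLR.
have := leq_add rA rB; rewrite euler mul2n -addnn addnACA addnA addnA !leq_add2r.
by rewrite addnC.
Qed.

(** The same with incidence functions: [rV] and [rF] are meant to choose a vertex and a contour in
    each component, where vanishing forces a locally constant function to be 0. *)
Lemma exact_of_euler (V E F C : finType) (SV : {set V}) (SE : {set E}) (SF : {set F})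
    (SC : {set C}) (a : V -> E -> K) (b : F -> E -> K)
    (rV : C -> V) (rF : C -> F) (x : E -> K) :
    (forall u : V -> K, {in SE, forall e, \sum_(v in SV) u v * a v e = 0} ->
       {in SC, forall c, u (rV c) = 0} -> {in SV, forall v, u v = 0}) ->
    (forall h : F -> K, {in SE, forall e, \sum_(f in SF) h f * b f e = 0} ->
       {in SC, forall c, h (rF c) = 0} -> {in SF, forall f, h f = 0}) ->
    {in SC, forall c, rV c \in SV} -> {in SC, forall c, rF c \in SF} ->
    (#|SV| + #|SF| = #|SE| + 2 * #|SC|)%N ->
    {in SF & SV, forall f v, \sum_(e in SE) b f e * a v e = 0} ->
    {in SV, forall v, \sum_(e in SE) x e * a v e = 0} ->
  exists h : F -> K, {in SE, forall e, x e = \sum_(f in SF) h f * b f e}.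
Proof.
move=> ker_a ker_b rVS rFS euler ab0 xa0.
(* Extension by zero of a vector on [S]; at most one index contributes. *)
pose ext (T : finType) (S : {set T}) (w : 'rV[K]_#|S|) (t : T) :=
  \sum_(i | enum_val i == t) w 0 i.
have extE (T : finType) (S : {set T}) (w : 'rV[K]_#|S|) i : ext T S w (enum_val i) = w 0 i.
  by rewrite /ext (big_pred1 i) // => j; rewrite (inj_eq enum_val_inj).
have ext_sum (T : finType) (S : {set T}) (w : 'rV[K]_#|S|) (g : T -> K) :
    \sum_(t in S) ext T S w t * g t = \sum_i w 0 i * g (enum_val i).
  by rewrite big_enum_val; apply: eq_bigr => i _; rewrite extE.
pose A := \matrix_(i < #|SV|, j < #|SE|) a (enum_val i) (enum_val j).
pose B := \matrix_(i < #|SF|, j < #|SE|) b (enum_val i) (enum_val j).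
have detect (T : finType) (S : {set T}) (g : T -> E -> K) (r : C -> T) :
    {in SC, forall c, r c \in S} ->
    (forall u : T -> K, {in SE, forall e, \sum_(v in S) u v * g v e = 0} ->
       {in SC, forall c, u (r c) = 0} -> {in S, forall v, u v = 0}) ->
    (#|S| <= \rank (\matrix_(i < #|S|, j < #|SE|) g (enum_val i) (enum_val j)) + #|SC|)%N.
  move=> rS ker_g.
  apply: (@leq_rank_detected _ _ _ _
    (\matrix_(i < #|S|, j < #|SC|) (enum_val i == r (enum_val j))%:R)) => u uA uP.
  apply/rowP=> i; rewrite -extE mxE; apply: ker_g (enum_valP i) => [e eS|c cS].
    rewrite ext_sum; move/rowP/(_ (enum_rank_in eS e)): uA; rewrite !mxE => uA.
    by rewrite -[RHS]uA; apply: eq_bigr => j _; rewrite mxE enum_rankK_in.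
  move/rowP/(_ (enum_rank_in cS c)): uP; rewrite !mxE => uP.
  rewrite -[RHS]uP /ext big_mkcond; apply: eq_bigr => j _.
  by rewrite mxE enum_rankK_in // mulr_natr mulrb.
have BA : B *m A^T = 0.
  apply/matrixP=> i j; rewrite !mxE -[RHS](ab0 _ _ (enum_valP i) (enum_valP j)).
  by rewrite [RHS]big_enum_val; apply: eq_bigr => k _; rewrite !mxE.
pose X := \row_(j < #|SE|) x (enum_val j).
have XA : X *m A^T = 0.
  apply/rowP=> j; rewrite !mxE -[RHS](xa0 _ (enum_valP j)).
  by rewrite [RHS]big_enum_val; apply: eq_bigr => k _; rewrite !mxE.
have /submxP[h Xh] :=
  exact_of_rank (detect _ _ _ _ rVS ker_a) (detect _ _ _ _ rFS ker_b) euler BA XA.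
exists (ext _ _ h) => e eS; rewrite ext_sum.
move/rowP/(_ (enum_rank_in eS e)): Xh; rewrite !mxE enum_rankK_in // => ->.
by apply: eq_bigr => j _; rewrite mxE enum_rankK_in.
Qed.

End Exactness.

(** * Even edge sets of a plane bipartite graph bound unions of contours *)

Lemma connect_constant (T : finType) (e : rel T) (A : Type) (u : T -> A) :
    (forall x y, e x y -> u x = u y) ->
  forall x y, connect e x y -> u x = u y.
Proof.
move=> ue x y /connectP[p]; elim: p x => [x _ -> //|z p IHp x /= /andP[/ue-> pz]].
exact: IHp.
Qed.

Lemma sum_bool_delta (T : finType) (S : {set T}) (u : T -> bool) t :
  t \in S -> \sum_(v in S) u v * (v == t) = u t.
Proof.
move=> tS; rewrite (bigD1 t) //= eqxx mulr1 big1 ?addr0 // => v /andP[_ /negPf->].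
exact: mulr0.
Qed.

Lemma porbit_step (T : finType) (p : {perm T}) x : porbit p (p x) = porbit p x.
Proof. by rewrite -[p x]/((p ^+ 1)%g x) porbit_perm. Qed.

Lemma perm_expS (T : finType) (p : {perm T}) i x : (p ^+ i.+1)%g x = p ((p ^+ i)%g x).
Proof. by rewrite expgSr permM. Qed.

Section PlaneBipartite.

Variables (V : finType) (G : sgraph V) (M : plane_embedding G) (black : V -> bool).
Hypothesis black_adj : forall x y, G x y -> black y = ~~ black x.

Notation head := Defs.head.
Notation rho := (Defs.rot M).
Notation phi := (contour (Defs.rot M)).

Lemma head_flip (d : dart G) : head (flip d) = tail d. Proof. by []. Qed.
Lemma tail_flip (d : dart G) : tail (flip d) = head d. Proof. by []. Qed.

Lemma dart_adj (d : dart G) : G (tail d) (head d).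
Proof. by case: d. Qed.

Lemma black_head (d : dart G) : black (head d) = ~~ black (tail d).
Proof. exact/black_adj/dart_adj. Qed.

Lemma contourE (d : dart G) : phi d = rho (flip d).
Proof. by rewrite permM permE. Qed.

Lemma mem_porbit_rot (d d' : dart G) : (d' \in porbit rho d) = (tail d' == tail d).
Proof. by rewrite rot_vertex inE. Qed.

Lemma tail_rot (d : dart G) : tail (rho d) = tail d.
Proof. by apply/eqP; rewrite -mem_porbit_rot -eq_porbit_mem porbit_step. Qed.

Lemma tail_contour (d : dart G) : tail (phi d) = head d.
Proof. by rewrite contourE tail_rot. Qed.

Lemma rot_orbit_constant (A : Type) (H : dart G -> A) :
    (forall d, H (rho d) = H d) ->
  forall d d', tail d = tail d' -> H d = H d'.
Proof.
move=> Hrot d d' /eqP; rewrite -mem_porbit_rot => /porbitP[i ->].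
by elim: i => [|i IHi]; rewrite ?expg0 ?perm1 // perm_expS Hrot.
Qed.

Lemma component_constant (A : Type) (H : dart G -> A) :
    (forall d, H (rho d) = H d) -> (forall d, H (flip d) = H d) ->
  forall d d', connect G (tail d) (tail d') -> H d = H d'.
Proof.
move=> Hrot Hflip d d' /connectP[p pG e]; move/esym: e.
elim: p d pG => [d _|y p IHp d /= /andP[xy pG]] e.
  by apply: rot_orbit_constant.
pose f : dart G := Sub (tail d, y) xy.
rewrite (@rot_orbit_constant _ H Hrot d f) // -Hflip; exact: IHp.
Qed.

Lemma sum_black_darts (F : dart G -> bool) :
  \sum_(d in [set d | black (tail d)]) (F d + F (flip d)) = \sum_d F d.
Proof.
rewrite big_split /= [RHS](bigID (fun d => black (tail d))) /=.
congr (_ + _); first by apply: eq_bigl => d; rewrite inE.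
rewrite [RHS](reindex_inj (can_inj (@flipK _ G))) /=; apply: eq_bigl => d.
by rewrite inE tail_flip black_head negbK.
Qed.

(* Here [bool] is the field F_2, with addition [(+)]. *)
Lemma planar_coboundary (x : dart G -> bool) :
    (forall d, x (flip d) = x d) ->
    (forall v, \sum_(d | tail d == v) x d = 0) ->
  exists2 s : dart G -> bool,
    forall d, s (phi d) = s d & forall d, s d (+) s (flip d) = x d.
Proof.
move=> xflip xcycle.
(* Each edge is represented by its dart with black tail, each component by its root. Isolated
   vertices are left out, as in [contour_euler]. *)
pose SV := [set v in non_isolated G]; pose SE := [set d : dart G | black (tail d)].
pose SC := [set v in [predI roots G & non_isolated G]].
pose a v (d : dart G) : bool := (v == tail d) + (v == head d).
pose b (O : {set dart G}) (d : dart G) : bool := (d \in O) + (flip d \in O).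
(* A contour passing at [v]; the default is not reached on [SC], whose vertices are not isolated. *)
pose rF v := if [pick d : dart G | tail d == v] is Some d then porbit phi d else set0.
have Gsym : connect_sym G by apply/sym_connect_sym/adj_sym.
have adart v w : G v w -> exists2 d : dart G, tail d = v & head d = w.
  by move=> vw; exists (Sub (v, w) vw).
have isoP v : reflect (exists d : dart G, tail d = v) (v \in non_isolated G).
  apply: (iffP existsP) => [[y /adart[d <- _]]|[d <-]]; first by exists d.
  by exists (head d); exact: dart_adj.
have tailS (d : dart G) : tail d \in SV by rewrite inE; apply/isoP; exists d.
have headS (d : dart G) : head d \in SV by rewrite -tail_flip.
have rootS v : v \in SV -> fingraph.root G v \in SC.
  rewrite !inE roots_root //= => vS; rewrite -[X in is_true X]/(_ \in non_isolated G).
  rewrite -(@connect_constant _ G _ (fun v => v \in non_isolated G) _ _ _ (connect_root G v)) //.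
  by move=> y z /adart[d <- <-]; move: (tailS d) (headS d); rewrite !inE => -> ->.
have orbS (d : dart G) : porbit phi d \in porbits phi by apply: imset_f.
have rFE (d : dart G) : exists2 d', tail d' = tail d & rF (tail d) = porbit phi d'.
  rewrite /rF; case: pickP => [d' /eqP|/(_ d)]; last by rewrite eqxx.
  by exists d'.
have kb (k : {set dart G} -> bool) d :
    \sum_(O in porbits phi) k O * b O d = k (porbit phi d) + k (porbit phi (flip d)).
  rewrite /b; under eq_bigr do rewrite mulrDr.
  rewrite big_split /=; congr (_ + _); rewrite -(sum_bool_delta k (orbS _));
  apply: eq_bigr => _ /imsetP[d' _ ->]; by rewrite eq_porbit_mem porbit_sym.
have [h xh] : exists h : {set dart G} -> bool,
    {in SE, forall d, x d = \sum_(O in porbits phi) h O * b O d}.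
  apply: (@exact_of_euler bool V (dart G) {set dart G} V SV SE (porbits phi) SC a b id rF x).
- move=> u ue uC.
  have uflip (d : dart G) : u (head d) = u (tail d).
    have uE (d0 : dart G) : d0 \in SE -> u (head d0) = u (tail d0).
      move=> /ue; rewrite /a; under eq_bigr do rewrite mulrDr.
      rewrite big_split /= !sum_bool_delta //.
      by case: (u (tail d0)); case: (u (head d0)).
    have [dS|] := boolP (d \in SE); first exact: uE.
    rewrite inE -black_head => fdS; have := uE (flip d).
    by rewrite inE head_flip tail_flip => ->.
  move=> v vS; rewrite -(uC _ (rootS _ vS)).
  apply: (@connect_constant _ G _ u _ _ _ (connect_root G v)).
  by move=> y z /adart[d <- <-].
(* A function of contours that agrees across every edge is invariant under flips, hence under
   rotations, hence constant on components. *)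
- move=> k ke kC.
  pose H d := k (porbit phi d).
  have Hflip d : H (flip d) = H d.
    have HE d0 : d0 \in SE -> H (flip d0) = H d0.
      by move=> /ke; rewrite kb -/(H d0) -/(H (flip d0)); case: (H d0); case: (H (flip d0)).
    have [dS|] := boolP (d \in SE); first exact: HE.
    rewrite inE -black_head => fdS; rewrite -[in RHS](@flipK _ G d).
    by rewrite (HE (flip d)) ?inE.
  have Hphi d : H (phi d) = H d by rewrite /H porbit_step.
  have Hrot d : H (rho d) = H d.
    by rewrite -[d in LHS](@flipK _ G) -contourE Hphi.
  move=> _ /imsetP[d _ ->]; rewrite -/(H d).
  have := rootS _ (tailS d) => rC; have := rC; rewrite inE => /andP[_ /isoP[d' rd']].
  have [d2 e2 r2] := rFE d'.
  rewrite (@component_constant _ H Hrot Hflip d d2).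
    by rewrite /H -r2 rd'; apply: kC.
  by rewrite e2 rd' connect_root.
- by move=> c; rewrite !inE => /andP[].
- by move=> c; rewrite inE => /andP[_ /isoP[d <-]]; have [d' _ ->] := rFE d.
- have := contour_euler M; rewrite cardsE => ->.
  congr (_ + _)%N; last by rewrite cardsE.
  rewrite -cardsT (@card_half_involution _ (@flip _ G) _ (fun d => black (tail d))).
  + by rewrite doubleK; apply: eq_card => d; rewrite !inE.
  + exact: flipK.
  + by move=> d; rewrite inE.
  by move=> d _; rewrite tail_flip black_head.
(* A contour enters each vertex as often as it leaves it: shifting by [phi] turns tails into
   heads. *)
- move=> O v /imsetP[d0 _ ->] vS; set F := porbit _ _.
  have Fsum : \sum_d ((d \in F) * (v == tail d) + (d \in F) * (v == head d)) = 0.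
    rewrite big_split /= (reindex_inj (@perm_inj _ phi)) /=.
    under eq_bigr do rewrite tail_contour -eq_porbit_mem porbit_step eq_porbit_mem.
    exact: addbb.
  rewrite -[RHS]Fsum -[RHS]sum_black_darts; apply: eq_bigr => d _.
  rewrite /b /a head_flip tail_flip.
  by case: (d \in F); case: (_ \in F); case: (v == _); case: (v == _).
- move=> v vS; rewrite -[RHS](xcycle v) [RHS]big_mkcond /=.
  rewrite -[RHS]sum_black_darts; apply: eq_bigr => d _.
  rewrite tail_flip xflip /a ![v == _]eq_sym.
  by case: eqP; case: eqP; case: (x d).
exists (fun d => h (porbit phi d)) => d; first by rewrite porbit_step.
move: d; have sE d : d \in SE -> h (porbit phi d) (+) h (porbit phi (flip d)) = x d.
  by move=> dS; rewrite xh // kb.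
move=> d; have [dS|] := boolP (d \in SE); first exact: sE.
by rewrite inE -black_head => fdS; rewrite -xflip -sE ?inE // (@flipK _ G) addbC.
Qed.

End PlaneBipartite.

(** * Two matchings and the region between them *)

Lemma odd_card_sum (T : finType) (A : {pred T}) : odd #|A| = \sum_(x in A) (1 : bool).
Proof. by rewrite -sum1_card (big_morph odd oddD (erefl (odd 0))). Qed.

Lemma sum_bool_odd (T : finType) (A : {set T}) (P : T -> bool) :
  \sum_(x in A) P x = odd #|[set x in A | P x]|.
Proof.
rewrite odd_card_sum big_mkcond [RHS]big_mkcond; apply: eq_bigr => x _.
by rewrite inE; case: (x \in A); case: (P x).
Qed.

Section TwoMatchings.

Variables (V : finType) (G : sgraph V) (M : plane_embedding G) (black : V -> bool).
Hypothesis black_adj : forall x y, G x y -> black y = ~~ black x.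
Variables mu mu' : V -> V.
Hypotheses (muK : involutive mu) (muK' : involutive mu').
Hypotheses (mu_adj : forall v, G v (mu v)) (mu_adj' : forall v, G v (mu' v)).

Notation head := Defs.head.
Notation rho := (Defs.rot M).
Notation phi := (contour (Defs.rot M)).

Definition mdart v : dart G := Sub (v, mu v) (mu_adj v).
Definition mdart' v : dart G := Sub (v, mu' v) (mu_adj' v).

Definition moved := [set v | mu v != mu' v].

(** The symmetric difference of the matchings: shared edges cancel in F_2. *)
Definition switch (d : dart G) : bool :=
  (head d == mu (tail d)) (+) (head d == mu' (tail d)).

Lemma dart_eq (d d' : dart G) : tail d = tail d' -> head d = head d' -> d = d'.
Proof.
case: d d' => [[v w] vw] [[v' w'] vw']; rewrite /tail /head /= => ev ew.
by apply: val_inj; rewrite /= ev ew.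
Qed.

Lemma head_mdart v (d : dart G) : tail d = v -> (head d == mu v) = (d == mdart v).
Proof.
move=> tv; apply/eqP/eqP => [hd|->]; last by [].
exact: dart_eq.
Qed.

Lemma head_mdart' v (d : dart G) : tail d = v -> (head d == mu' v) = (d == mdart' v).
Proof.
move=> tv; apply/eqP/eqP => [hd|->]; last by [].
exact: dart_eq.
Qed.

Lemma switch_flip d : switch (flip d) = switch d.
Proof.
rewrite /switch head_flip tail_flip.
rewrite [tail d == mu _]eq_sym [tail d == mu' _]eq_sym.
by rewrite (can2_eq muK muK) (can2_eq muK' muK').
Qed.

Lemma switch_cycle v : \sum_(d | tail d == v) switch d = 0.
Proof.
have E (d0 : dart G) : tail d0 == v -> \sum_(d | tail d == v) (d == d0) = 1 :> bool.
  move=> t0; rewrite (bigD1 d0) //= eqxx big1 ?addr0 // => d /andP[_ /negPf->].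
  by [].
under eq_bigr => d /eqP td.
  rewrite /switch td head_mdart // head_mdart' // -[_ (+) _]/(_ + _); over.
by rewrite big_split /= !E //; apply/eqP.
Qed.

Lemma eq_mdart v : (mdart v == mdart' v) = (mu v == mu' v).
Proof. by rewrite -head_mdart'. Qed.

Lemma switchP d :
  reflect (tail d \in moved /\ (d = mdart (tail d) \/ d = mdart' (tail d))) (switch d).
Proof.
rewrite /switch head_mdart // head_mdart' //; move: (tail d) => v.
rewrite inE -eq_mdart.
apply: (iffP idP) => [|[n [->|->]]].
- have [->|n1] := eqVneq d (mdart v); first by rewrite addTb => ->; split=> //; left.
  rewrite addFb => /eqP e; split; last by right.
  by rewrite -e eq_sym.
- by rewrite eqxx addTb.
- by rewrite eqxx eq_sym (negPf n).
Qed.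

Lemma switch_mdart v : switch (mdart v) = (v \in moved).
Proof.
by rewrite /switch head_mdart // head_mdart' // eqxx eq_mdart inE.
Qed.

Lemma switch_mdart' v : switch (mdart' v) = (v \in moved).
Proof.
by rewrite /switch head_mdart // head_mdart' // eqxx eq_sym eq_mdart inE addbT.
Qed.

Lemma flip_mdart v : flip (mdart v) = mdart (mu v).
Proof. by apply: dart_eq => //; rewrite head_flip; apply/esym/muK. Qed.

Lemma flip_mdart' v : flip (mdart' v) = mdart' (mu' v).
Proof. by apply: dart_eq => //; rewrite head_flip; apply/esym/muK'. Qed.

Lemma moved_mu v : (mu v \in moved) = (v \in moved).
Proof. by rewrite -!switch_mdart -flip_mdart switch_flip. Qed.

Lemma moved_mu' v : (mu' v \in moved) = (v \in moved).
Proof. by rewrite -!switch_mdart' -flip_mdart' switch_flip. Qed.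

(** * A union [s] of contours bounded by the symmetric difference *)

Section Region.

Variable s : dart G -> bool.
Hypothesis s_contour : forall d, s (phi d) = s d.
Hypothesis s_switch : forall d, s d (+) s (flip d) = switch d.

Lemma s_rot d : s (rho d) = s (flip d).
Proof. by rewrite -[s (flip d)]s_contour contourE (@flipK _ G). Qed.

Lemma s_flip d : s (flip d) = s d (+) switch d.
Proof. by rewrite -s_switch addKb. Qed.

(** Turning once around [v], the region is left as often as it is entered. The sums must be taken in
    the natural numbers: modulo 2 the two switching darts give a trivial identity. *)
Lemma s_mdart v : v \in moved -> s (mdart v) = ~~ s (mdart' v).
Proof.
move=> vm; have nm : mdart' v != mdart v by move: vm; rewrite inE -eq_mdart eq_sym.
have rotE : (\sum_(d | tail d == v) s (flip d) = \sum_(d | tail d == v) s d)%N.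
  rewrite [RHS](reindex_inj (@perm_inj _ rho)) /=.
  by apply: eq_big => d; rewrite ?tail_rot // s_rot.
move: rotE; rewrite (bigD1 (mdart v)) //= (bigD1 (mdart' v)) /=; last by rewrite eqxx.
rewrite [RHS](bigD1 (mdart v)) //= [in RHS](bigD1 (mdart' v)) /=; last by rewrite eqxx.
rewrite [X in (_ + (_ + X) = _)%N](eq_bigr (fun d => nat_of_bool (s d))); last first.
  move=> d /andP[/andP[/eqP td n1] n2]; rewrite s_flip.
  suff /negPf-> : ~~ switch d by rewrite addbF.
  by apply/switchP; rewrite td => -[_ [e|e]]; rewrite e eqxx in n1 n2.
rewrite !addnA => /addIn; rewrite !s_flip switch_mdart switch_mdart' vm.
by case: (s (mdart v)); case: (s (mdart' v)).
Qed.

(* The boundary of the region [s] leaves [v] along [outd v] and enters it     *)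
(* along the reverse of [ind v].                                              *)
Definition outd v := if s (mdart v) then mdart v else mdart' v.
Definition ind v := if s (mdart v) then mdart' v else mdart v.

Lemma tail_outd v : tail (outd v) = v. Proof. by rewrite /outd; case: ifP. Qed.
Lemma tail_ind v : tail (ind v) = v. Proof. by rewrite /ind; case: ifP. Qed.

Lemma s_outd v : v \in moved -> s (outd v).
Proof. by move=> vm; rewrite /outd; case: ifPn => //; rewrite s_mdart ?negbK. Qed.

Lemma s_ind v : v \in moved -> s (ind v) = false.
Proof.
move=> vm; rewrite /ind; case: ifPn => [|/negPf //].
by rewrite s_mdart // => /negPf.
Qed.

Lemma switch_outd v : switch (outd v) = (v \in moved).
Proof. by rewrite /outd; case: ifP; rewrite ?switch_mdart ?switch_mdart'. Qed.

Lemma switch_ind v : switch (ind v) = (v \in moved).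
Proof. by rewrite /ind; case: ifP; rewrite ?switch_mdart ?switch_mdart'. Qed.

Lemma outd_boundary d : s d -> s (flip d) = false -> tail d \in moved /\ d = outd (tail d).
Proof.
move=> sd sfd; have /switchP[tm dE] : switch d by rewrite -s_switch sd sfd.
split=> //; move: dE tm sd {sfd}; move: (tail d) => v dE vm sd.
case: dE => e; rewrite /outd; move: sd; rewrite {1}e; first by move->.
by rewrite s_mdart // => ->.
Qed.

Lemma ind_boundary d : s d = false -> s (flip d) -> tail d \in moved /\ d = ind (tail d).
Proof.
move=> sd sfd; have /switchP[tm dE] : switch d by rewrite -s_switch sd sfd.
split=> //; move: dE tm sd {sfd}; move: (tail d) => v dE vm sd.
case: dE => e; rewrite /ind; move: sd; rewrite {1}e; first by move->.
by rewrite s_mdart // => ->.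
Qed.

Lemma head_outd_moved v : v \in moved -> head (outd v) \in moved.
Proof. by rewrite /outd; case: ifP; rewrite ?moved_mu ?moved_mu'. Qed.

Lemma head_ind_moved v : (head (ind v) \in moved) = (v \in moved).
Proof. by rewrite /ind; case: ifP; rewrite ?moved_mu ?moved_mu'. Qed.

Lemma ind_head_outd v : v \in moved -> ind (head (outd v)) = flip (outd v).
Proof.
move=> vm; have [||_ /esym] := @ind_boundary (flip (outd v)); last by [].
  by rewrite s_flip s_outd // switch_outd vm.
by rewrite (@flipK _ G) s_outd.
Qed.

Lemma outd_head_ind v : v \in moved -> outd (head (ind v)) = flip (ind v).
Proof.
move=> vm; have [||_ /esym] := @outd_boundary (flip (ind v)); last by [].
  by rewrite s_flip s_ind // switch_ind vm.
by rewrite (@flipK _ G) s_ind.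
Qed.

(** One step along the boundary of the region; the nontrivial cycles are the alternating cycles of
    the two matchings. *)
Definition next v := if v \in moved then head (outd v) else v.

Lemma next_inj : injective next.
Proof.
apply: (@can_inj _ _ _ (fun v => if v \in moved then head (ind v) else v)) => v.
rewrite /next; have [vm|/negPf vm] := boolP (v \in moved); last by rewrite vm.
by rewrite head_outd_moved // ind_head_outd // head_flip tail_outd.
Qed.

Definition next_perm := perm next_inj.

(** * Signs of the permutations restricted to the region *)

Variable ob : dart G -> bool.
Hypothesis ob_flip : forall d, ob (flip d) = ~~ ob d.
Hypothesis ob_contour : forall d, odd #|[set d' in porbit phi d | ob d']|.

Let region := [set d | s d].
Let inner := [set d | s d && s (flip d)].
Let boundary := [set d | s d && ~~ s (flip d)].

Let region_contour d := if s d then phi d else d.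

Lemma region_contour_inj : injective region_contour.
Proof.
move=> d d'; rewrite /region_contour.
case: ifP => sd; case: ifP => sd' //; first exact: perm_inj.
  by move=> e; rewrite -e s_contour sd in sd'.
by move=> e; rewrite e s_contour sd' in sd.
Qed.

Let contour_perm := perm region_contour_inj.

Let turn d := if s d then if s (flip d) then flip d else outd (head d) else d.

Lemma turn_inj : injective turn.
Proof.
pose g d := if s d then if s (flip d) then flip d else flip (ind (tail d)) else d.
apply: (@can_inj _ _ _ g) => d; rewrite /turn /g.
have [sd|/negPf sd] := boolP (s d); last by rewrite sd.
have [sfd|/negPf sfd] := boolP (s (flip d)); first by rewrite sfd (@flipK _ G) sd.
have [|hm e] := ind_boundary sfd; first by rewrite (@flipK _ G).
rewrite tail_flip in hm e.
by rewrite s_outd // s_flip s_outd // switch_outd hm tail_outd -e (@flipK _ G).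
Qed.

Let turn_perm := perm turn_inj.

Let inner_flip d := if s d && s (flip d) then flip d else d.

Lemma inner_flipK : involutive inner_flip.
Proof.
move=> d; rewrite /inner_flip.
have [/andP[sd sfd]|/negPf e] := boolP (s d && s (flip d)); last by rewrite e.
by rewrite (@flipK _ G) sd sfd.
Qed.

Let inner_perm := perm (inv_inj inner_flipK).
Let boundary_perm := (inner_perm * turn_perm)%g.
(* [contour_perm] is [turn_perm] followed by [corner_perm]: [turn_perm] stays *)
(* inside the region, following its boundary where flipping would leave it,   *)
(* so that [corner_perm] is the rotation around the vertices restricted to    *)
(* the region.                                                                *)
Let corner_perm := (turn_perm^-1 * contour_perm)%g.

Lemma contour_permE d : contour_perm d = if s d then phi d else d. Proof. exact: permE. Qed.
Lemma turn_permE d :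
  turn_perm d = if s d then if s (flip d) then flip d else outd (head d) else d.
Proof. exact: permE. Qed.
Lemma inner_permE d : inner_perm d = if s d && s (flip d) then flip d else d.
Proof. exact: permE. Qed.

(** The flips of inner darts cancel, leaving only the walk along the boundary. *)
Lemma boundary_permE d : boundary_perm d = if s d && ~~ s (flip d) then outd (head d) else d.
Proof.
rewrite permM inner_permE; have [sd|/negPf sd] := boolP (s d); last by rewrite turn_permE sd.
have [sfd|/negPf sfd] := boolP (s (flip d)); last by rewrite turn_permE sd sfd.
by rewrite turn_permE sfd (@flipK _ G) sd.
Qed.

(** Rotation leaves the region just after [outd v] and returns to it just after [ind v]; the sector
    between them is skipped. *)
Lemma corner_permE d : s d -> corner_perm d = if s (rho d) then rho d else rho (ind (tail d)).
Proof.
move=> sd; rewrite s_rot permM; case: ifP => sfd.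
  have -> : d = turn_perm (flip d) by rewrite turn_permE sfd (@flipK _ G) sd.
  by rewrite permK contour_permE turn_permE sfd (@flipK _ G) sd contourE (@flipK _ G).
have [tm e] := outd_boundary sd sfd.
have sfi : s (flip (ind (tail d))) by rewrite s_flip s_ind // switch_ind tm.
have {1}-> : d = turn_perm (flip (ind (tail d))).
  by rewrite turn_permE sfi (@flipK _ G) s_ind // head_flip tail_ind.
by rewrite permK contour_permE sfi contourE (@flipK _ G).
Qed.

Lemma corner_perm_out d : s d = false -> corner_perm d = d.
Proof.
move=> sd; have {1}-> : d = turn_perm d by rewrite turn_permE sd.
by rewrite permM permK contour_permE sd.
Qed.

Lemma s_corner_perm d : s (corner_perm d) = s d.
Proof.
have [sd|/negPf sd] := boolP (s d); last by rewrite corner_perm_out.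
rewrite corner_permE //; case: ifP => //; rewrite s_rot => sfd.
have [tm e] := outd_boundary sd sfd.
by rewrite s_rot s_flip s_ind // switch_ind tm.
Qed.

Lemma tail_corner_perm d : tail (corner_perm d) = tail d.
Proof.
have [sd|/negPf sd] := boolP (s d); last by rewrite corner_perm_out.
by rewrite corner_permE //; case: ifP; rewrite !tail_rot ?tail_ind.
Qed.

(** At most one sector is skipped at a vertex, so its darts in the region form a single cycle. *)
Lemma porbit_corner_perm d : s d -> porbit corner_perm d = [set d' in region | tail d' == tail d].
Proof.
move=> sd; apply/setP=> d'; rewrite !inE; apply/idP/andP => [/porbitP[i ->]|[sd']].
  elim: i => [|i [IHs IHt]]; first by rewrite expg0 perm1.
  by rewrite perm_expS s_corner_perm tail_corner_perm.
rewrite -(mem_porbit_rot M) => /porbitP[i d'E]; move: sd'; rewrite {d'}d'E.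
(* Invariant along the rotation: while it is outside the region, the dart [outd v] from which it
   left is already in the orbit. *)
suff [] : (s ((rho ^+ i)%g d) -> (rho ^+ i)%g d \in porbit corner_perm d) /\
          (s ((rho ^+ i)%g d) = false -> outd (tail d) \in porbit corner_perm d
              /\ tail d \in moved).
  by [].
have tailX j : tail ((rho ^+ j)%g d) = tail d.
  by elim: j => [|j IHj]; rewrite ?expg0 ?perm1 // perm_expS tail_rot.
have step d0 : d0 \in porbit corner_perm d -> corner_perm d0 \in porbit corner_perm d.
  by rewrite -!eq_porbit_mem porbit_step.
elim: i => [|i]; first by rewrite expg0 perm1 sd porbit_id.
rewrite perm_expS; move: (tailX i); move: ((rho ^+ i)%g d) => e te [IHs IHns].
have [se|/negPf se] := boolP (s e).
  split=> sre.
    by have := step _ (IHs se); rewrite corner_permE // sre.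
  rewrite s_rot in sre; have [em eE] := outd_boundary se sre.
  by rewrite -te -eE; split; [exact: IHs|].
have [zo tm] := IHns se; split=> // sre.
rewrite s_rot in sre; have [em eE] := ind_boundary se sre.
have := step _ zo; rewrite corner_permE ?s_outd // s_rot s_flip s_outd // switch_outd tm /=.
by rewrite tail_outd -te -eE.
Qed.

Lemma porbit_contour_perm d : s d -> porbit contour_perm d = porbit phi d.
Proof.
move=> sd.
have E i : (contour_perm ^+ i)%g d = (phi ^+ i)%g d /\ s ((phi ^+ i)%g d).
  elim: i => [|i [IHc IHs]]; first by rewrite !expg0 perm1.
  by rewrite !perm_expS IHc contour_permE IHs s_contour.
by apply/setP=> d'; apply/porbitP/porbitP => -[i ->]; exists i; case: (E i).
Qed.

(** [mu] pairs these vertices. A moved vertex and its mate both have their [outd] in the region;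
    around any other vertex [s] is constant, so the region has both sides of the matching edge. *)
Lemma even_region_vertices : ~~ odd #|[set tail d | d in region]|.
Proof.
rewrite (@card_half_involution _ mu _ black) ?odd_double //.
  move=> v /imsetP[d sd ->]; rewrite inE in sd.
  have [tm|tm] := boolP (tail d \in moved).
    apply/imsetP; exists (outd (mu (tail d))); last by rewrite tail_outd.
    by rewrite inE s_outd // moved_mu.
  apply/imsetP; exists (flip (mdart (tail d))); last by [].
  rewrite inE s_flip switch_mdart (negPf tm) addbF.
  suff -> : s (mdart (tail d)) = s d by [].
  have : mdart (tail d) \in porbit rho d by rewrite mem_porbit_rot.
  case/porbitP=> i ->; elim: i => [|i IHi]; first by rewrite expg0 perm1.
  rewrite perm_expS s_rot s_flip IHi.
  have : tail ((rho ^+ i)%g d) = tail d.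
    by apply/eqP; rewrite -(mem_porbit_rot M) mem_porbit.
  move: ((rho ^+ i)%g d) => e te.
  suff /negPf-> : ~~ switch e by rewrite addbF.
  by apply/switchP; rewrite te => -[em _]; rewrite em in tm.
by move=> v _; apply: black_adj.
Qed.

Lemma odd_corner_perm : odd_perm corner_perm = odd #|region|.
Proof.
rewrite (@odd_perm_fix_out _ _ region); last first.
  by move=> d; rewrite inE => /negPf; apply: corner_perm_out.
have -> : #|[set porbit corner_perm d | d in region]| = #|[set tail d | d in region]|.
  pose g v := [set d' in region | tail d' == v].
  have -> : [set porbit corner_perm d | d in region] = g @: [set tail d | d in region].
    rewrite -imset_comp; apply: eq_in_imset => d; rewrite inE => sd.
    exact: porbit_corner_perm.
  apply: card_in_imset => _ _ /imsetP[d dS ->] /imsetP[d' d'S ->] /setP/(_ d).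
  by rewrite !inE eqxx andbT => e; move: dS; rewrite inE e => /andP[_ /eqP].
by rewrite (negPf even_region_vertices) addbF.
Qed.

(** The cycles in the region are contours, and the Kasteleyn condition replaces the 1 counted for
    each by its sum of [ob]. *)
Lemma odd_contour_perm : odd_perm contour_perm = odd #|region| (+) \sum_(d in region) ob d.
Proof.
rewrite (@odd_perm_fix_out _ _ region); last first.
  by move=> d; rewrite inE contour_permE => /negPf->.
congr (_ (+) _).
rewrite (eq_in_imset (g := porbit phi)); last by move=> d; rewrite inE => /porbit_contour_perm.
rewrite odd_card_sum (partition_big_imset (porbit phi)).
apply: eq_bigr => _ /imsetP[d dS ->]; rewrite inE in dS.
have := ob_contour d; rewrite -sum_bool_odd => /esym/eqP; rewrite -[true]/(1 : bool) => /eqP ->.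
apply: eq_bigl => d'; rewrite eq_porbit_mem inE andbC.
case: porbitP => //= -[i ->]; symmetry.
elim: i => [|i IHi]; first by rewrite expg0 perm1.
by rewrite perm_expS s_contour.
Qed.

(** Inner edges are counted once by their darts with black tail and once by their darts agreeing
    with the orientation. *)
Lemma odd_inner_perm : odd_perm inner_perm = \sum_(d in inner) ob d.
Proof.
have innerF d : d \in inner -> flip d \in inner.
  by rewrite !inE (@flipK _ G) andbC.
have -> : odd_perm inner_perm = odd #|[set d in inner | black (tail d)]|.
  have iA (d : dart G) : black (tail (flip d)) = ~~ black (tail d).
    by rewrite tail_flip (black_head black_adj).
  apply: odd_perm_involution.
  - by move=> d; rewrite !permE; apply: inner_flipK.
  - move=> d; rewrite inE => /andP[di bd0]; rewrite inner_permE.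
    have /[!inE] -> := di; by rewrite iA bd0 andbF.
  move=> d; rewrite inner_permE; case: ifP => // di.
  have {}di : d \in inner by rewrite inE.
  have inS d0 : d0 \in inner -> (d0 \in [set d in inner | black (tail d)]) = black (tail d0).
    by move=> i0; rewrite [LHS]in_set i0.
  by rewrite !inS ?innerF // iA => /negPf->.
rewrite sum_bool_odd; congr odd; apply: double_inj.
have flipA := @flipK _ G.
rewrite -(card_half_involution flipA innerF); last first.
  by move=> d _; rewrite tail_flip (black_head black_adj).
by apply: (card_half_involution flipA innerF) => d _; apply: ob_flip.
Qed.

(** In [turn_perm] followed by [corner_perm] the parity of the region cancels; composing with
    [inner_perm] then removes the inner darts. *)
Lemma odd_boundary_perm : odd_perm boundary_perm = \sum_(d in boundary) ob d.
Proof.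
have odd_turn_perm : odd_perm turn_perm = \sum_(d in region) ob d.
  have : contour_perm = (turn_perm * corner_perm)%g by rewrite mulKVg.
  move/(congr1 (@odd_perm _)); rewrite odd_permM odd_contour_perm odd_corner_perm.
  by case: odd; case: odd_perm; case: (\sum_(d in region) _).
rewrite odd_permM odd_inner_perm odd_turn_perm [X in _ (+) X](big_setID inner) /=.
have -> : region :&: inner = inner.
  by apply/setP=> d; rewrite !inE andbA andbb.
have -> : region :\: inner = boundary.
  by apply/setP=> d; rewrite !inE; case: (s d); rewrite ?andbT.
exact: addKb.
Qed.

(** [tail] carries the boundary darts bijectively to the moved vertices. *)
Lemma odd_next_perm : odd_perm next_perm = \sum_(v in moved) ob (outd v).
Proof.
have boundaryP d : d \in boundary -> tail d \in moved /\ d = outd (tail d).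
  by rewrite inE => /andP[sd /negPf]; apply: outd_boundary.
have outd_in_boundary v : v \in moved -> outd v \in boundary.
  by move=> vm; rewrite inE s_flip s_outd // switch_outd vm.
have boundaryE : boundary = outd @: moved.
  apply/setP=> d; apply/idP/imsetP => [/boundaryP[tm ->]|[v vm ->]].
    by exists (tail d).
  exact: outd_in_boundary.
rewrite -(@odd_perm_transport _ _ boundary_perm boundary next_perm (@tail _ G)).
- rewrite odd_boundary_perm boundaryE big_imset //= => v w _ _.
  by move/(congr1 (@tail _ G)); rewrite !tail_outd.
- by move=> d d' /boundaryP[_ {2}->] /boundaryP[_ {2}->] ->.
- by move=> d; rewrite inE boundary_permE => /negPf->.
- move=> v; rewrite permE /next; case: ifP => // vm /negP[].
  by apply/imsetP; exists (outd v); rewrite ?tail_outd ?outd_in_boundary.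
move=> d db; have [tm e] := boundaryP d db; rewrite permE /next tm -e boundary_permE.
by move: db; rewrite inE => ->; rewrite tail_outd.
Qed.

(** Colours direct each alternating cycle for [alt], the region directs it for [next]. On [P] the
    directions agree, elsewhere they are opposite. *)
Lemma odd_next_perm_alternating (alt : {perm V}) :
    (forall v, alt v = if v \in moved then if black v then mu v else mu' v else v) ->
  odd_perm next_perm = odd_perm alt.
Proof.
move=> altE; pose P := [set v | (v \in moved) ==> (s (mdart v) == black v)].
have s_mu v : v \in moved -> s (mdart (mu v)) = ~~ s (mdart v).
  by move=> vm; rewrite -flip_mdart s_flip switch_mdart vm addbT.
have s_mu' v : v \in moved -> s (mdart (mu' v)) = ~~ s (mdart v).
  move=> vm; rewrite s_mdart ?moved_mu' // -flip_mdart' s_flip switch_mdart' vm addbT.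
  by rewrite s_mdart.
have bmu v : black (mu v) = ~~ black v by apply: black_adj.
have bmu' v : black (mu' v) = ~~ black v by apply: black_adj.
have inP v : (v \in P) = ((v \in moved) ==> (s (mdart v) == black v)) by rewrite in_set.
apply: (@odd_perm_reverse _ _ _ P) => v.
- rewrite !inP altE; have [vm|/negPf vm] := boolP (v \in moved); last by rewrite /= ?vm.
  case: ifP => bv; rewrite ?moved_mu ?moved_mu' ?vm /= ?s_mu ?s_mu' // ?bmu ?bmu' bv.
    by case: (s _).
  by case: (s _).
- rewrite inP altE permE /next; case: ifP => //= vm /eqP <-.
  by rewrite /outd; case: ifP.
rewrite inP negb_imply altE permE /next => /andP[vm]; rewrite vm => sb.
have [bv|/negPf bv] := boolP (black v); rewrite bv in sb;
  rewrite ?moved_mu ?moved_mu' ?vm /outd ?s_mu ?s_mu' //.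
  by move: sb; case: (s _) => // _; apply: muK.
by move: sb; case: (s _) => // _; apply: muK'.
Qed.

(** The boundary dart leaving a white vertex is the reverse of [ind v] for the black vertex [v]
    where it ends; reversing it produces the 1. *)
Lemma sum_boundary_orientation :
  \sum_(v in moved) ob (outd v)
    = \sum_(v in moved | black v) (1 + (ob (mdart v) + ob (mdart' v)) : bool).
Proof.
rewrite (bigID black) /=.
rewrite [X in _ + X](reindex_onto (fun v => head (ind v)) (fun v => head (outd v))).
  rewrite [X in _ + X](eq_bigl (fun v => (v \in moved) && black v)) => [|v].
    rewrite -big_split /=; apply: eq_bigr => v /andP[vm bv].
    rewrite outd_head_ind // ob_flip /outd /ind.
    by case: ifP => _; case: (ob _); case: (ob _).
  rewrite head_ind_moved; have [vm|//] := boolP (v \in moved).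
  rewrite outd_head_ind // head_flip tail_ind eqxx andbT /=.
  by rewrite (black_head black_adj) tail_ind negbK.
move=> v /andP[vm _].
by rewrite ind_head_outd // head_flip tail_outd.
Qed.

End Region.

Theorem alternating_parity (ob : dart G -> bool) (alt : {perm V}) :
    (forall d, ob (flip d) = ~~ ob d) ->
    (forall d, odd #|[set d' in porbit phi d | ob d']|) ->
    (forall v, alt v = if v \in moved then if black v then mu v else mu' v else v) ->
  odd_perm alt = \sum_(v in moved | black v) (1 + (ob (mdart v) + ob (mdart' v)) : bool).
Proof.
move=> ob_flip ob_contour altE.
have [s sphi ssw] := planar_coboundary M black_adj switch_flip switch_cycle.
rewrite -(sum_boundary_orientation sphi ssw ob_flip).
by rewrite -(odd_next_perm_alternating sphi ssw altE)
  (odd_next_perm sphi ssw ob_flip ob_contour).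
Qed.

End TwoMatchings.

(** * Kasteleyn's theorem *)

Section BipartiteDeterminant.

Variables (R : numFieldType) (N : nat) (G : sgraph ('I_N + 'I_N)%type).

Let black (v : 'I_N + 'I_N) : bool := if v is inl _ then true else false.

Definition perm_covering (sigma : 'S_N) : bool := [forall b, is_edge G (b, sigma b)].

Definition mate (sigma : 'S_N) (v : 'I_N + 'I_N) : 'I_N + 'I_N :=
  match v with inl b => inr (sigma b) | inr w => inl ((sigma^-1)%g w) end.

Lemma mateK sigma : involutive (mate sigma).
Proof. by case=> [b|w] /=; rewrite ?permK ?permKV. Qed.

Lemma mate_adj sigma : perm_covering sigma -> forall v, G v (mate sigma v).
Proof.
move=> /forallP cs [b|w] /=; first exact: cs.
by rewrite adj_sym; have := cs ((sigma^-1)%g w); rewrite /is_edge /= permKV.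
Qed.

Lemma kasteleyn_sign_parity (M : plane_embedding G) (o : rel ('I_N + 'I_N)) (sigma tau : 'S_N) :
    bipartite G -> kasteleyn_orientation M o ->
    perm_covering sigma -> perm_covering tau ->
  odd_perm sigma (+) odd_perm tau
    = \sum_b (o (inl b) (inr (sigma b)) + o (inl b) (inr (tau b)) : bool).
Proof.
move=> [bb ww] [o_flip o_odd] cs ct.
have black_adj x y : G x y -> black y = ~~ black x.
  by case: x y => [b|w] [b'|w'] //= xy; [have := bb b b' | have := ww w w']; rewrite xy.
pose mov := [set v | mate sigma v != mate tau v].
have movE v : (mate sigma v \in mov) = (v \in mov).
  by rewrite !inE mateK eq_sym (can2_eq (mateK tau) (mateK tau)).
have pairK : involutive (fun v => if v \in mov then mate sigma v else v).
  by move=> v; have [vm|/negPf vm] := boolP (v \in mov); rewrite ?movE vm ?mateK.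
have lift_inj : injective (fun v : 'I_N + 'I_N =>
    if v is inl b then inl ((tau^-1)%g (sigma b)) else v).
  by move=> [b|w] [b'|w'] //= [] /perm_inj/perm_inj->.
(* [pairs] then [lift] is the alternating permutation. The sign of [pairs] is the parity of the
   moved black vertices, which cancels the 1s in [alternating_parity]; [lift] carries the sign of
   sigma and tau. *)
pose pairs := perm (inv_inj pairK); pose lift := perm lift_inj.
have odd_lift : odd_perm lift = odd_perm sigma (+) odd_perm tau.
  rewrite -(odd_permV tau) -odd_permM; symmetry.
  apply: (@odd_perm_transport _ _ _ [set: 'I_N] lift inl).
  - by move=> b b' _ _ [].
  - by move=> b; rewrite inE.
  - case=> [b|w]; last by rewrite permE.
    by case/negP; apply/imsetP; exists b.
  by move=> b _; rewrite permE permM.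
have odd_pairs : odd_perm pairs = odd #|[set v in mov | black v]|.
  apply: odd_perm_involution.
  - by move=> v; rewrite !permE; apply: pairK.
  - move=> v; rewrite inE => /andP[vm bv]; rewrite permE vm inE.
    by rewrite (black_adj _ _ (mate_adj cs v)) bv andbF.
  move=> v; rewrite permE; case: ifP => // vm.
  have inS u : u \in mov -> (u \in [set v in mov | black v]) = black u.
    by move=> um; rewrite [LHS]in_set um.
  by rewrite !inS ?movE // (black_adj _ _ (mate_adj cs v)) => /negPf->.
have altE v : (pairs * lift)%g v =
    if v \in mov then if black v then mate sigma v else mate tau v else v.
  rewrite permM !permE; case: ifP => [vm|].
    by case: v {vm} => [b|w] //=; rewrite permKV.
  by case: v => [b|w] //; rewrite inE => /negbFE/eqP[/= ->]; rewrite permK.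
have ob_flip (d : dart G) : o (tail (flip d)) (Defs.head (flip d)) = ~~ o (tail d) (Defs.head d).
  by rewrite tail_flip head_flip o_flip // dart_adj.
have := @alternating_parity _ G M black black_adj _ _ (mateK sigma) (mateK tau)
  (mate_adj cs) (mate_adj ct) (fun d => o (tail d) (Defs.head d)) (pairs * lift)%g
  ob_flip o_odd altE.
rewrite odd_permM odd_pairs odd_lift big_split /=.
rewrite [X in _ = X + _](_ : _ = odd #|[set v in mov | black v]|); last first.
  by rewrite odd_card_sum; apply: eq_bigl => v; rewrite inE.
move/addbI => ->; rewrite big_mkcond big_sumType /= [X in _ + X]big1 ?addr0 => [|w _]; last first.
  by rewrite andbF.
apply: eq_bigr => b _; rewrite andbT inE /=.
by case: eqP => //= -[->]; rewrite [RHS]addbb.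
Qed.

End BipartiteDeterminant.

(** * Sylvester's identity and restriction to the ends of E *)

Lemma det_1_mulmxC (R : comPzRingType) m n (A : 'M[R]_(m, n)) (B : 'M[R]_(n, m)) :
  \det (1%:M + A *m B) = \det (1%:M + B *m A).
Proof.
(* Multiplying [X] by a unitriangular matrix on the right or on the left makes it block triangular,
   so both determinants equal that of [X]. *)
pose X := block_mx 1%:M (- A) B 1%:M.
have XU : X *m block_mx 1%:M A 0 1%:M = block_mx 1%:M 0 B (1%:M + B *m A).
  rewrite mulmx_block !mulmx1 !mul1mx !mulmx0 !addr0; congr block_mx; first by rewrite subrr.
  by rewrite addrC.
have UX : block_mx 1%:M A 0 1%:M *m X = block_mx (1%:M + A *m B) 0 B 1%:M.
  by rewrite mulmx_block !mulmx1 !mul1mx !mul0mx !add0r addNr.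
have := congr1 determinant XU; rewrite det_mulmx det_ublock det_lblock !det1 !mul1r !mulr1 => <-.
by have := congr1 determinant UX; rewrite det_mulmx det_ublock det_lblock !det1 !mul1r !mulr1.
Qed.

Section Submatrices.

Variables (R : numFieldType) (N : nat) (E : {set 'I_N * 'I_N}) (K : 'M[R]_N).

Lemma tilde_mxE : tilde_mx E K = K - 2%:R *: prime_mx E K.
Proof.
apply/matrixP=> b w; rewrite !mxE; case: ifP => _; last by rewrite mulr0 subr0.
by rewrite mulr_natl mulr2n opprD addrA subrr sub0r.
Qed.

Definition incl_mx (I : {set 'I_N}) : 'M[R]_(#|I|, N) :=
  rowsub (enum_val (A := mem I)) 1%:M.

Lemma submx_onE (I J : {set 'I_N}) (A : 'M[R]_N) :
  submx_on I J A = incl_mx I *m A *m (incl_mx J)^T.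
Proof.
apply/matrixP=> i j; rewrite /submx_on /incl_mx !mxE.
rewrite (bigD1 (enum_val j)) //= big1 ?addr0 => [|k /negPf nk].
  rewrite !mxE eqxx mulr1 (bigD1 (enum_val i)) //= !mxE eqxx mul1r big1 ?addr0 // => k /negPf nk.
  by rewrite !mxE eq_sym nk mul0r.
by rewrite !mxE eq_sym nk mulr0.
Qed.

Lemma incl_mxK (I : {set 'I_N}) :
  (incl_mx I)^T *m incl_mx I = \matrix_(i, j) ((i == j) && (i \in I))%:R.
Proof.
apply/matrixP=> i j; rewrite !mxE.
transitivity (\sum_(k in I) (k == i)%:R * (k == j)%:R : R).
  by rewrite [RHS]big_enum_val; apply: eq_bigr => k _; rewrite !mxE.
have [iI|iI] := boolP (i \in I).
  rewrite (bigD1 i) //= eqxx mul1r andbT big1 ?addr0 // => k /andP[_ /negPf->].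
  by rewrite mul0r.
rewrite andbF big1 // => k kI; case: eqP => [ki|_]; last by rewrite mul0r.
by rewrite -ki kI in iI.
Qed.

Lemma prime_mx_support :
  (incl_mx (black_ends E))^T *m incl_mx (black_ends E) *m prime_mx E K
    *m ((incl_mx (white_ends E))^T *m incl_mx (white_ends E)) = prime_mx E K.
Proof.
rewrite !incl_mxK; apply/matrixP=> b w.
rewrite mxE (bigD1 w) //= [X in _ + X]big1 ?addr0 => [|k /negPf nk]; last first.
  by rewrite [X in _ * X]mxE nk mulr0.
rewrite [X in X * _]mxE (bigD1 b) //= [X in _ + X]big1 ?addr0 => [|k]; last first.
  by rewrite eq_sym [X in X * _]mxE => /negPf->; rewrite mul0r.
rewrite !mxE !eqxx /=; case: ifP => [bwE|_]; last by rewrite mulr0 mul0r.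
have -> : b \in black_ends E by apply/imsetP; exists (b, w).
have -> : w \in white_ends E by apply/imsetP; exists (b, w).
by rewrite mul1r mulr1.
Qed.

(** The quotient is the determinant of 1 - 2 K' K^-1. Factoring K' through the selections [P] of
    rows and [Q] of columns, Sylvester's identity moves [P^T] to the right end. *)
Lemma det_tilde_ratio : K \in unitmx ->
  \det (tilde_mx E K) / \det K
    = \det (1%:M - 2%:R *: (submx_on (black_ends E) (white_ends E) (prime_mx E K)
                            *m submx_on (white_ends E) (black_ends E) (invmx K))).
Proof.
move=> Ku; rewrite -det_inv -det_mulmx tilde_mxE mulmxBl mulmxV // -scalemxAl.
rewrite !submx_onE.
set P := incl_mx (black_ends E); set Q := incl_mx (white_ends E).
rewrite -{1}prime_mx_support -/P -/Q -!scaleNr.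
pose S := P *m prime_mx E K *m Q^T *m Q *m invmx K.
transitivity (\det (1%:M + (- 2%:R *: P^T) *m S)).
  by rewrite -scalemxAl /S !mulmxA.
by rewrite det_1_mulmxC -scalemxAr /S !mulmxA.
Qed.

End Submatrices.

(** * Dimer coverings as permutations, and both determinants as weighted counts *)

Section Coverings.

Variables (R : numFieldType) (N : nat) (G : sgraph ('I_N + 'I_N)%type).

Definition perm_graph (sigma : 'S_N) : {set 'I_N * 'I_N} := [set (b, sigma b) | b : 'I_N].

Lemma mem_perm_graph sigma b w : ((b, w) \in perm_graph sigma) = (w == sigma b).
Proof.
apply/imsetP/eqP => [[b' _ [-> ->]] //|->]; by exists b.
Qed.

Lemma perm_graph_inj : injective perm_graph.
Proof.
move=> sigma tau e; apply/permP=> b; apply/eqP.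
by rewrite -mem_perm_graph -e mem_perm_graph.
Qed.

Lemma perm_graph_covering sigma : perm_covering G sigma -> dimer_covering G (perm_graph sigma).
Proof.
move=> /forallP cs; apply/and3P; split.
- by apply/forall_inP => _ /imsetP[b _ ->].
- apply/forallP=> b; apply/cards1P; exists (b, sigma b).
  apply/setP=> -[b' w]; rewrite !inE /= mem_perm_graph xpair_eqE andbC.
  by case: eqP => // ->.
apply/forallP=> w; apply/cards1P; exists ((sigma^-1)%g w, w).
apply/setP=> -[b w']; rewrite !inE /= mem_perm_graph xpair_eqE andbC.
have [-> /=|] := eqVneq w' w; last by rewrite andbF.
by rewrite andbT -(can2_eq (permKV sigma) (permK sigma)) eq_sym.
Qed.

Lemma covering_perm_graph C :
  dimer_covering G C -> exists2 sigma, perm_covering G sigma & C = perm_graph sigma.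
Proof.
case/and3P=> /forall_inP Cedge /forallP Cb /forallP Cw.
have ex b : exists w, (b, w) \in C.
  have /cards1P[[b' w] /setP/(_ (b', w))] := Cb b.
  by rewrite !inE eqxx => /andP[bw /eqP/= <-]; exists w.
have uniqb b w w' : (b, w) \in C -> (b, w') \in C -> w = w'.
  move=> bw bw'; have /cards1P[e /setP eE] := Cb b.
  have := eE (b, w); have := eE (b, w'); rewrite !inE bw bw' /= eqxx.
  by move=> /esym/eqP <- /esym/eqP[].
have uniqw b b' w : (b, w) \in C -> (b', w) \in C -> b = b'.
  move=> bw bw'; have /cards1P[e /setP eE] := Cw w.
  have := eE (b, w); have := eE (b', w); rewrite !inE bw bw' /= eqxx.
  by move=> /esym/eqP <- /esym/eqP[].
have exP b := xchooseP (ex b).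
have sinj : injective (fun b => xchoose (ex b)).
  by move=> b b' e; apply: uniqw (exP b) _; rewrite e.
have sE b w : ((b, w) \in C) = (w == perm sinj b).
  rewrite permE; apply/idP/eqP => [bw|->]; last exact: exP.
  exact: uniqb bw (exP b).
exists (perm sinj); first by apply/forallP=> b; apply: Cedge; rewrite sE.
by apply/setP=> -[b w]; rewrite sE mem_perm_graph.
Qed.

Lemma sum_coverings (F : {set 'I_N * 'I_N} -> R) :
  \sum_(C | dimer_covering G C) F C = \sum_(sigma | perm_covering G sigma) F (perm_graph sigma).
Proof.
transitivity (\sum_(C in perm_graph @: perm_covering G) F C).
  apply: eq_bigl => C; apply/idP/imsetP => [/covering_perm_graph[sigma cs ->]|[sigma cs ->]].
    by exists sigma.
  exact: perm_graph_covering.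
by rewrite big_imset //= => sigma tau _ _; apply: perm_graph_inj.
Qed.

Lemma card_perm_graphI sigma (E : {set 'I_N * 'I_N}) :
  #|perm_graph sigma :&: E| = (\sum_b ((b, sigma b) \in E))%N.
Proof.
rewrite -sum1_card (eq_bigl (fun e => (e \in perm_graph sigma) && (e \in E))); last first.
  by move=> e; rewrite inE.
rewrite big_mkcondr big_imset /=; last by move=> b b' _ _ [].
by apply: eq_bigr => b _; case: (_ \in E).
Qed.

Lemma kasteleyn_term (M : plane_embedding G) (K : 'M[R]_N) sigma tau :
    bipartite G -> kasteleyn_matrix M K -> perm_covering G sigma -> perm_covering G tau ->
  (-1) ^+ sigma * \prod_b K b (sigma b) = (-1) ^+ tau * \prod_b K b (tau b).
Proof.
move=> bip [o ko ->] cs ct.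
have prodE (rho : 'S_N) : perm_covering G rho ->
    \prod_b (\matrix_(b, w) if is_edge G (b, w) then
                              if o (inl b) (inr w) then 1 else -1 else 0) b (rho b)
      = (-1) ^+ (\sum_b (~~ o (inl b) (inr (rho b)) : bool))%R :> R.
  move=> /forallP cr; rewrite (big_morph (fun x : bool => (-1) ^+ x) (@signr_addb R) (erefl _)).
  by apply: eq_bigr => b _; rewrite mxE cr; case: (o _ _).
rewrite !prodE // -!signr_addb; congr (_ ^+ nat_of_bool _).
have := kasteleyn_sign_parity bip ko cs ct.
(* An entry is -1 when [o] fails; negating both summands keeps their sum in F_2. *)
rewrite (eq_bigr (fun b => ~~ o (inl b) (inr (sigma b)) + ~~ o (inl b) (inr (tau b)))); last first.
  by move=> b _; case: (o _ _); case: (o _ _).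
rewrite big_split /=.
by case: (\sum_i _); case: (\sum_i _); case: odd_perm; case: odd_perm.
Qed.

(** Only coverings contribute, each by its weight times the common term of det K. The weights will
    be 1 for [K] and the vison sign for [tilde_mx]. *)
Lemma det_kasteleyn (K A : 'M[R]_N) (sigma0 : 'S_N) (wt : 'S_N -> R) :
    (forall b w, ~~ is_edge G (b, w) -> A b w = 0) ->
    (forall sigma : 'S_N, perm_covering G sigma ->
      \prod_b A b (sigma b) = wt sigma * \prod_b K b (sigma b)) ->
    (forall sigma : 'S_N, perm_covering G sigma ->
      (-1) ^+ sigma * \prod_b K b (sigma b) = (-1) ^+ sigma0 * \prod_b K b (sigma0 b)) ->
  \det A = (-1) ^+ sigma0 * \prod_b K b (sigma0 b)
            * \sum_(sigma | perm_covering G sigma) wt sigma.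
Proof.
move=> A0 AK Kterm; rewrite /determinant (bigID (perm_covering G)) /= [X in _ + X]big1 ?addr0.
  rewrite mulr_sumr; apply: eq_bigr => sigma cs.
  by rewrite AK // mulrCA Kterm // mulrC.
move=> sigma /forallPn[b nb]; rewrite (bigD1 b) //= A0 // mul0r; exact: mulr0.
Qed.

End Coverings.

Theorem mainTheorem2 (R : numFieldType) (N : nat)
    (G : sgraph ('I_N + 'I_N)%type) (M : plane_embedding G) (K : 'M[R]_N)
    (f g : face M) (p : seq (dart G)) :
  bipartite G ->
  (exists C, dimer_covering G C) ->
  kasteleyn_matrix M K ->
  face_path f p g ->
  let E := crossed_edges p in
  let BE := black_ends E in
  let WE := white_ends E in
  [/\ K \in unitmx,
      dimer_average G (fun C => (-1) ^+ #|C :&: E|)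
        = (\sum_(C | dimer_covering G C) (-1) ^+ #|C :&: E|)
          / (\sum_(C | dimer_covering G C) 1) :> R,
      (\sum_(C | dimer_covering G C) (-1) ^+ #|C :&: E|)
          / (\sum_(C | dimer_covering G C) 1)
        = \det (tilde_mx E K) / \det K,
      \det (tilde_mx E K) / \det K
        = \det (1%:M - 2%:R *: (submx_on BE WE (prime_mx E K)
                                *m submx_on WE BE (invmx K)))
    & {in E &, forall e e', e.1 = e'.1 \/ e.2 = e'.2 -> e = e'} ->
      #|BE| = #|E|].
Proof.
move=> bip [C0 /covering_perm_graph[sigma0 c0 _]] kast _ E BE WE.
have Kterm (sigma : 'S_N) : perm_covering G sigma ->
    (-1) ^+ sigma * \prod_b K b (sigma b) = (-1) ^+ sigma0 * \prod_b K b (sigma0 b).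
  by move=> cs; apply: kasteleyn_term bip kast cs c0.
have [K_out K_edge] : (forall b w, ~~ is_edge G (b, w) -> K b w = 0) /\
    (forall b w, is_edge G (b, w) -> K b w != 0).
  case: kast => o _ ->; split=> b w e; rewrite mxE; first by rewrite (negPf e).
  by rewrite e; case: ifP; rewrite ?oppr_eq0 oner_eq0.
(* The common value of the nonzero terms of det K. *)
pose eps := (-1) ^+ sigma0 * \prod_b K b (sigma0 b).
have eps_neq0 : eps != 0.
  rewrite mulf_neq0 ?signr_eq0 //; apply/prodf_neq0 => b _.
  exact/K_edge/(forallP c0).
have detK : \det K = eps * \sum_(C | dimer_covering G C) 1.
  rewrite sum_coverings; apply: det_kasteleyn => // sigma _; exact: esym (mul1r _).
have detT : \det (tilde_mx E K) = eps * \sum_(C | dimer_covering G C) (-1) ^+ #|C :&: E|.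
  rewrite sum_coverings; apply: det_kasteleyn => // [b w nbw|sigma _].
    by rewrite mxE K_out // oppr0 if_same.
  rewrite card_perm_graphI (big_morph _ (exprD (-1 : R)) (expr0 _)) -big_split /=.
  by apply: eq_bigr => b _; rewrite mxE; case: ifP => _; rewrite ?mulN1r ?mul1r.
have count_neq0 : \sum_(C | dimer_covering G C) 1 != 0 :> R.
  rewrite sumr_const pnatr_eq0 -lt0n; apply/card_gt0P; exists (perm_graph sigma0).
  exact: perm_graph_covering.
have Ku : K \in unitmx by rewrite unitmxE unitfE detK mulf_neq0.
split=> //.
- rewrite /dimer_average mulrC mulr_sumr; apply: eq_bigr => C _.
  by rewrite sumr_const cardsE.
- by rewrite detK detT -mulf_div divff // mul1r.
- exact: det_tilde_ratio.
by move=> Einj; apply: card_in_imset => e e' eE e'E e1; apply: Einj => //; left.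
Qed.
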